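(* For any strongly symmetric norm $F$ on $\mathbb{R}^2$ and any irrational $\alpha\in\mathbb{R}$ we have $\delta_F(\alpha)\geq \tfrac12$.
   Context: A norm $F$ on $\mathbb{R}^2$ is strongly symmetric if $F(x,y)=F(|x|,|y|)$ for all $(x,y)\in\mathbb{R}^2$ and $F(0,\pm1)=F(\pm1,0)=1$. For $t>0$ put $F_t(x,y)=F(t^{-1}x,ty)$. Let $\mathcal{B}=\{P\in\mathbb{R}^2:F(P)<1\}$ and let $\Delta=\Delta_F$ be the minimal area of a parallelogram with one vertex at the origin and the other three vertices on the boundary of $\mathcal{B}$. For irrational $\alpha$, $\delta_F(\alpha)$ denotes the largest real number with the following property: if $c>\delta_F(\alpha)$ then for every sufficiently large real $t$ there exist integers $p,q$ with $q>0$ and $\Delta\,F_t(q,p-\alpha q)^2<c$, while if $c<\delta_F(\alpha)$ there are arbitrarily large $t$ for which no such $p,q$ exist. *)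

(* Defs.v *)
From HB Require Import structures.
From mathcomp Require Import all_boot all_order all_algebra.
From mathcomp Require Import all_classical all_reals all_analysis.

Set Implicit Arguments.
Unset Strict Implicit.
Unset Printing Implicit Defensive.

Import Order.TTheory GRing.Theory Num.Theory.
Import numFieldNormedType.Exports.

Local Open Scope classical_set_scope.
Local Open Scope ring_scope.

Section Defs.
Context {R : realType}.
Implicit Types (F : R * R -> R) (P Q : R * R) (a c d t x y : R).

Definition is_norm F : Prop :=
  [/\ forall P, 0 <= F P,
      forall P, F P = 0 -> P = 0,
      forall a P, F (a *: P) = `|a| * F P
    & forall P Q, F (P + Q) <= F P + F Q].

Definition strongly_symmetric F : Prop :=
  [/\ forall x y, F (x, y) = F (`|x|, `|y|),
      F (0, 1) = 1, F (0, -1) = 1, F (1, 0) = 1 & F (-1, 0) = 1].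

Definition scaled_norm F t : R * R -> R := fun P => F (t^-1 * P.1, t * P.2).

Definition unit_ball F : set (R * R) := [set P | F P < 1].

Definition boundary (A : set (R * R)) : set (R * R) := closure A `\` interior A.

(* Areas of the parallelograms with vertices 0, P, P + Q, Q whose three nonzero
   vertices lie on the boundary of the unit ball.  Degenerate parallelograms need
   no exclusion: if F P = F Q = 1 with P and Q collinear, then Q = P or Q = - P,
   so that F (P + Q) is 2 or 0. *)
Definition parallelogram_areas F : set R :=
  [set s | exists P Q,
     [/\ boundary (unit_ball F) P, boundary (unit_ball F) Q,
         boundary (unit_ball F) (P + Q)
       & s = `|P.1 * Q.2 - P.2 * Q.1|]].

(* The infimum is a minimum: see Delta_min. *)
Definition Delta F : R := inf (parallelogram_areas F).

Definition has_approx F (alpha c t : R) : Prop :=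
  exists p q : int,
    0 < q /\ Delta F * scaled_norm F t (q%:~R, p%:~R - alpha * q%:~R) ^+ 2 < c.

Definition threshold F (alpha : R) : set R :=
  [set d | (forall c, d < c -> \forall t \near +oo, has_approx F alpha c t) /\
           (forall c, c < d ->
              forall T : R, exists2 t, T < t & ~ has_approx F alpha c t)].

(* At most one real is a threshold (threshold_unique), so this supremum is the
   largest threshold whenever one exists (delta_threshold).  The supremum of the
   empty set is 0, so a positive lower bound on delta includes existence. *)
Definition delta F (alpha : R) : R := sup (threshold F alpha).

Lemma threshold_unique F alpha d d' :
  threshold F alpha d -> threshold F alpha d' -> d = d'.
Proof.
suff H (u v : R) : threshold F alpha u -> threshold F alpha v -> v <= u.
  by move=> td td'; apply/le_anti; rewrite !H.
move=> [uP _] [_ vP]; rewrite leNgt; apply/negP => uv.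
have [uc cv] := midf_lt uv.
have [T [_ TP]] := uP _ uc.
by have [t Tt] := vP _ cv T; apply; exact: TP.
Qed.

Lemma delta_threshold F alpha d : threshold F alpha d -> delta F alpha = d.
Proof.
move=> td; rewrite /delta (_ : threshold F alpha = [set d]) ?sup1//.
by apply/seteqP; split => [d' td'|_ ->//]; exact: threshold_unique td' td.
Qed.

Lemma norm_le_sum F P : is_norm F -> strongly_symmetric F ->
  F P <= `|P.1| + `|P.2|.
Proof.
move=> [_ _ FZ FD] [_ F01 _ F10 _]; case: P => x y /=.
rewrite (_ : (x, y) = x *: (1, 0) + y *: (0, 1)).
  by apply: (le_trans (FD _ _)); rewrite !FZ F01 F10 !mulr1.
by apply/eqP; rewrite -pair_eqE /= /GRing.scale /= !mulr1 !mulr0 addr0 add0r !eqxx.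
Qed.

Lemma norm_continuous F : is_norm F -> strongly_symmetric F -> continuous F.
Proof.
move=> Fn Fs P; have [_ _ FZ FD] := Fn.
apply/cvgrPdist_le => e e0.
have e20 : 0 < e / 2 by rewrite divr_gt0.
have : \forall Q \near P, `|P - Q| <= e / 2.
  by apply/nbhs_ballP; exists (e / 2) => //= Q; rewrite -ball_normE => /ltW.
apply: filterS => Q /= PQ.
have le_dist A B : F A - F B <= F (A - B).
  by rewrite lerBlDr; apply: le_trans (FD _ _); rewrite subrK.
apply: (@le_trans _ _ (F (P - Q))).
  rewrite ler_norml le_dist andbT lerNl opprB (le_trans (le_dist _ _))//.
  by rewrite -opprB -scaleN1r FZ normrN1 mul1r.
apply: (le_trans (norm_le_sum _ Fn Fs)); rewrite [leRHS]splitr.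
by move: PQ; rewrite {1}/Num.norm /= ge_max => /andP[? ?]; exact: lerD.
Qed.

Lemma boundary_unit_ball F : is_norm F -> strongly_symmetric F ->
  boundary (unit_ball F) = [set P | F P = 1].
Proof.
move=> Fn Fs; have Fc := norm_continuous Fn Fs; have [_ _ FZ _] := Fn.
have oB : open (unit_ball F).
  by apply: (@open_comp _ _ F [set x | x < 1]) => //; exact: open_lt.
rewrite /boundary (interior_id _).1//; apply/seteqP; split => P /=.
  move=> [cP /negP]; rewrite -leNgt => F1; apply/eqP; rewrite eq_le F1 andbT.
  have cl : closed [set Q | F Q <= 1].
    by apply: (@preimage_closed _ _ F [set x | x <= 1]) => //; exact: closed_le.
  by apply: cl; apply: closure_subset cP => Q /=; exact: ltW.
move=> FP; split; last by rewrite /unit_ball /= FP ltxx.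
move=> A PA.
have : \forall s \near (1 : R), A (s *: P).
  have : (s *: P) @[s --> (1 : R)] --> 1 *: P by apply: cvgZr_tmp; exact: cvg_id.
  by rewrite scale1r; apply.
move=> /nbhs_ballP[e /= e0 Ae].
pose s : R := 1 - Num.min (e / 2) 1.
have m0 : 0 < Num.min (e / 2) 1 by rewrite lt_min divr_gt0//=.
have m1 : Num.min (e / 2) 1 <= 1 by rewrite ge_min lexx orbT.
have me : Num.min (e / 2) 1 < e by rewrite gt_min gtr_pMr// invf_lt1// ltr1n.
exists (s *: P); split.
  rewrite /unit_ball /= FZ FP mulr1 ger0_norm; last by rewrite subr_ge0.
  by rewrite ltrBlDr ltrDl.
by apply: Ae; rewrite /ball /= /s opprB addrC subrK gtr0_norm.
Qed.

Lemma norm_ge_coord F x y : is_norm F -> strongly_symmetric F ->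
  `|x| <= F (x, y) /\ `|y| <= F (x, y).
Proof.
move=> [_ _ FZ FD] [Fs F01 _ F10 _].
have two : (0 : R) < 2 by [].
split; rewrite -(ler_pM2l two).
  have -> : 2 * `|x| = F ((2 * x) *: (1, 0)) by rewrite FZ F10 mulr1 normrM gtr0_norm.
  have -> : (2 * x) *: (1, 0) = (x, y) + (x, - y) :> R * R.
    apply/eqP; rewrite -pair_eqE /= /GRing.scale /= mulr1 mulr0 subrr eqxx andbT.
    by rewrite mulr_natl mulr2n.
  apply: (le_trans (FD _ _)); rewrite [F (x, - y)]Fs normrN -Fs.
  by rewrite mulr_natl mulr2n.
have -> : 2 * `|y| = F ((2 * y) *: (0, 1)) by rewrite FZ F01 mulr1 normrM gtr0_norm.
have -> : (2 * y) *: (0, 1) = (x, y) + (- x, y) :> R * R.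
  apply/eqP; rewrite -pair_eqE /= /GRing.scale /= mulr1 mulr0 subrr eqxx /=.
  by rewrite mulr_natl mulr2n.
apply: (le_trans (FD _ _)); rewrite [F (- x, y)]Fs normrN -Fs.
by rewrite mulr_natl mulr2n.
Qed.

Lemma parallelogram_areas_neq0 F : is_norm F -> strongly_symmetric F ->
  parallelogram_areas F !=set0.
Proof.
move=> Fn Fs; have Fc := norm_continuous Fn Fs.
have [Fsym F01 _ F10 _] := Fs; have [_ _ FZ _] := Fn.
pose g y := F (2^-1, y).
have gc : continuous g.
  move=> y; apply: (@cvg_comp R (R * R)%type R (fun z : R => (2^-1, z)) F _
      (nbhs ((2^-1, y) : R * R)%type)); last exact: Fc.
  apply: (@cvg_pair R R R (nbhs y) (nbhs (2^-1 : R)) (nbhs y) _ _ _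
      (fun=> 2^-1) id).
    exact: cvg_cst.
  exact: cvg_id.
have g0 : g 0 = 2^-1.
  rewrite /g (_ : (2^-1, 0) = 2^-1 *: (1, 0)).
    by rewrite FZ F10 mulr1 ger0_norm.
  by apply/eqP; rewrite -pair_eqE /= /GRing.scale /= mulr1 mulr0 !eqxx.
have g1 : 1 <= g 1.
  by have [_] := norm_ge_coord 2^-1 1 Fn Fs; rewrite normr1.
have [|y _ gy] := @IVT R g 0 1 1 ler01 (@continuous_subspaceT _ _ _ g gc).
  by rewrite g0 ge_min le_max g1 orbT andbT invf_le1// ler1n.
rewrite /parallelogram_areas boundary_unit_ball//.
exists `|1 * y - 0 * - 2^-1|; exists (1, 0), (- 2^-1, y); split => //=.
  by rewrite Fsym normrN -Fsym.
have -> : (1, 0) + (- 2^-1, y) = (2^-1, y) :> R * R; last exact: gy.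
apply/eqP; rewrite -pair_eqE /= add0r eqxx andbT.
by rewrite [X in X - _](splitr 1) mul1r addrK.
Qed.

Lemma Delta_min F : is_norm F -> strongly_symmetric F ->
  parallelogram_areas F (Delta F) /\ lbound (parallelogram_areas F) (Delta F).
Proof.
move=> Fn Fs; have Fc := norm_continuous Fn Fs.
have [s0 As0] := parallelogram_areas_neq0 Fn Fs.
suff [s As slb] : exists2 s, parallelogram_areas F s &
    lbound (parallelogram_areas F) s.
  suff -> : Delta F = s by [].
  apply/le_anti/andP; split; first by apply: ge_inf => //; exists s.
  by apply: lb_le_inf => //; exists s.
pose K := [set u : (R * R) * (R * R) | [/\ F u.1 = 1, F u.2 = 1 & F (u.1 + u.2) = 1]].
pose f (u : (R * R) * (R * R)) := `|u.1.1 * u.2.2 - u.1.2 * u.2.1|.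
have areaE : parallelogram_areas F = f @` K.
  rewrite /parallelogram_areas boundary_unit_ball//; apply/seteqP; split => s /=.
    by move=> [P [Q [p q pq ->]]]; exists (P, Q).
  by move=> [[P Q] [/= p q pq] <-]; exists P, Q.
have K0 : K !=set0 by move: As0; rewrite areaE => -[u Ku _]; exists u.
have cK : compact K.
  pose I := `[(-1 : R), 1]%classic.
  apply: (@subclosed_compact _ _ ((I `*` I) `*` (I `*` I))).
  - have cl (h : (R * R) * (R * R) -> R * R) : continuous h ->
        closed [set u | F (h u) = 1].
      move=> hc; apply: (@preimage_closed _ _ (F \o h) [set x | x = 1]).
        by move=> u _; apply: continuous_comp; [exact: hc|exact: Fc].
      exact: closed_eq.
    rewrite (_ : K = [set u | F (fst u) = 1] `&` [set u | F (snd u) = 1] `&`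
        [set u | F (u.1 + u.2) = 1]).
      apply: closedI; first apply: closedI; apply: cl => u.
      + exact: cvg_fst.
      + exact: cvg_snd.
      + by apply: cvgD; [exact: cvg_fst|exact: cvg_snd].
    by apply/seteqP; split => [u []//|u [[]]].
  - by do 2 apply: compact_setX; (try apply: compact_setX); exact: segment_compact.
  - move=> [[x y] [z w]] [/= Fx Fz _].
    have [] := norm_ge_coord x y Fn Fs; have [] := norm_ge_coord z w Fn Fs.
    by rewrite Fx Fz !ler_norml /I /= !in_itv /= => -> -> -> ->.
have fc : {within K, continuous f}.
  apply: continuous_subspaceT => u; rewrite /f; apply: (@cvg_norm _ R).
  have c1 : u0.1 @[u0 --> u] --> u.1 by exact: cvg_fst.
  have c2 : u0.2 @[u0 --> u] --> u.2 by exact: cvg_snd.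
  have c11 : u0.1.1 @[u0 --> u] --> u.1.1 by apply: cvg_comp c1 _; exact: cvg_fst.
  have c12 : u0.1.2 @[u0 --> u] --> u.1.2 by apply: cvg_comp c1 _; exact: cvg_snd.
  have c21 : u0.2.1 @[u0 --> u] --> u.2.1 by apply: cvg_comp c2 _; exact: cvg_fst.
  have c22 : u0.2.2 @[u0 --> u] --> u.2.2 by apply: cvg_comp c2 _; exact: cvg_snd.
  by apply: cvgB; apply: cvgM.
have [u /set_mem Ku umin] := compact_EVT_min K0 cK fc.
exists (f u); rewrite areaE; first by exists u.
by move=> _ [v Kv <-]; apply: umin; rewrite inE.
Qed.

End Defs.

(* Main.v *)
Require Import Defs.
From HB Require Import structures.
From mathcomp Require Import all_boot all_order all_algebra.
From mathcomp Require Import all_classical all_reals all_analysis.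
From mathcomp Require Import ring lra.

Import Order.TTheory GRing.Theory Num.Theory.
Import numFieldNormedType.Exports.

Local Open Scope ring_scope.

(* If P, Q and P + Q have norm 1, then any two vectors of norm at most m span a
   parallelogram of area at most 2 |det P Q| m^2; hence |det U V| <= 2 Delta m^2.
   The points (q, p - alpha q) span parallelograms of integer area, and F_t only
   rescales by a map of determinant 1, so for c < 1/2 all points with
   Delta F_t^2 < c lie, at any given t, on one rational line.  If such points
   existed for all large t, this line would be locally constant in t, hence
   constant, which is impossible because alpha is irrational and F_t tends to
   infinity along a fixed rational line.  Finiteness of the threshold is
   Dirichlet's theorem. *)

(** * Determinant bound for norms with an inscribed affine regular hexagon *)

Section HexagonalNorm.
Set Implicit Arguments.
Unset Strict Implicit.
Context {R : realFieldType}.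
Implicit Types (N : R -> R -> R) (a m x y : R).

(** [N] stands for a norm in the coordinates of a basis [P], [Q] with [P], [Q], [P + Q] of norm 1.
    These points and their negatives are the vertices of an affine regular hexagon. *)
Definition hexagonal_norm N : Prop :=
  [/\ forall a x y, N (a * x) (a * y) = `|a| * N x y,
      forall x y x' y', N (x + x') (y + y') <= N x y + N x' y',
      N 1 0 = 1, N 0 1 = 1 & N 1 1 = 1].

(** [N] composed with the linear map of determinant 1 and order six that permutes the vertices of
    the hexagon cyclically. *)
Definition hexagon_rotation N : R -> R -> R := fun x y => N (x - y) x.

Lemma hexagonal_normN N x y : hexagonal_norm N -> N (- x) (- y) = N x y.
Proof. by case=> NZ _ _ _ _; rewrite -mulN1r -[- y]mulN1r NZ normrN1 mul1r. Qed.

Lemma hexagonal_norm_rotation N :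
  hexagonal_norm N -> hexagonal_norm (hexagon_rotation N).
Proof.
move=> HN; have [NZ ND N10 N01 N11] := HN; rewrite /hexagon_rotation; split.
- by move=> a x y; rewrite -mulrBr NZ.
- by move=> x y x' y'; rewrite opprD addrACA; exact: ND.
- by rewrite subr0.
- by rewrite sub0r -[0]oppr0 hexagonal_normN.
- by rewrite subrr.
Qed.

Lemma hexagon_rotationE N x y : N x y = hexagon_rotation N y (y - x).
Proof. by rewrite /hexagon_rotation opprB addrC subrK. Qed.

(** The numbers [y] and [x - y] are the coordinates in the basis (1,1), (1,0). Adding [x - y] times
    (0,1) gives [x] times (1,1), subtracting [y] times (0,1) gives [x] times (1,0); the triangle
    inequality bounds [x] in both cases. *)
Lemma sector_bound N m x y : hexagonal_norm N -> 0 <= y <= x -> N x y <= m ->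
  y <= m /\ x - y <= m.
Proof.
move=> [NZ ND N10 N01 N11] /andP[y0 yx] Nm.
have x0 : 0 <= x by lra.
split.
  have := ND x y ((x - y) * 0) ((x - y) * 1).
  rewrite NZ N01 (ger0_norm (_ : 0 <= x - y)); last by lra.
  rewrite (_ : x + _ = x * 1); last by ring.
  rewrite (_ : y + _ = x * 1); last by ring.
  by rewrite NZ N11 ger0_norm//; lra.
have := ND x y ((- y) * 0) ((- y) * 1).
rewrite NZ N01 normrN ger0_norm//.
rewrite (_ : x + _ = x * 1); last by ring.
rewrite (_ : y + _ = x * 0); last by ring.
by rewrite NZ N10 ger0_norm//; lra.
Qed.

Lemma hexagonal_normC N : hexagonal_norm N -> hexagonal_norm (fun x y => N y x).
Proof. by case=> NZ ND N10 N01 N11; split. Qed.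

Lemma det_same_sector N m x y x' y' : hexagonal_norm N ->
  0 <= y <= x -> 0 <= y' <= x' -> N x y <= m -> N x' y' <= m ->
  `|x * y' - y * x'| <= 2 * m ^+ 2.
Proof.
move=> HN s s' h h'.
have [b1 b2] := sector_bound HN s h; have [b1' b2'] := sector_bound HN s' h'.
by rewrite ler_norml; apply/andP; split; nra.
Qed.

Lemma det_adjacent_sectors N m x y x' y' : hexagonal_norm N ->
  0 <= y <= x -> 0 <= x' <= y' -> N x y <= m -> N x' y' <= m ->
  `|x * y' - y * x'| <= 2 * m ^+ 2.
Proof.
move=> HN s s' h h'.
have [b1 b2] := sector_bound HN s h.
have [b1' b2'] := sector_bound (hexagonal_normC HN) s' h'.
have [NZ ND _ _ N11] := HN.
(* This nonnegative combination of the two points is the determinant times (1,1), the vertex between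
   the sectors; its weights are at most [m] by [sector_bound]. *)
have := ND ((y' - x') * x) ((y' - x') * y) ((x - y) * x') ((x - y) * y').
have -> : (y' - x') * x + (x - y) * x' = (x * y' - y * x') * 1 by ring.
have -> : (y' - x') * y + (x - y) * y' = (x * y' - y * x') * 1 by ring.
have m0 : 0 <= m by lra.
rewrite !NZ N11 mulr1 (ger0_norm (_ : 0 <= x - y)); last by lra.
rewrite (ger0_norm (_ : 0 <= y' - x')); last by lra.
by move/le_trans; apply; nra.
Qed.

Lemma sector_cases x y : exists e, [/\ e = 1 \/ e = -1 &
  [\/ 0 <= e * y <= e * x, 0 <= e * x <= e * y | e * x <= 0 <= e * y]].
Proof.
have [y0|/ltW y0] := leP 0 y.
  exists 1; split; [by left|rewrite !mul1r].
  have [x0|/ltW x0] := leP 0 x; last by apply: Or33; apply/andP.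
  have [xy|/ltW xy] := leP x y; [apply: Or32|apply: Or31]; exact/andP.
exists (-1); split; [by right|rewrite !mulN1r].
have [x0|/ltW x0] := leP x 0; last by apply: Or33; apply/andP; split; lra.
have [xy|/ltW xy] := leP x y; [apply: Or31|apply: Or32];
  by apply/andP; split; lra.
Qed.

Lemma det_sign x y x' y' e : e = 1 \/ e = -1 ->
  `|x * y' - y * x'| = `|(e * x) * y' - (e * y) * x'|.
Proof.
by case=> ->; rewrite ?mul1r// -normrN; congr (`| _ |); ring.
Qed.

Lemma hexagonal_norm_sign N x y e : hexagonal_norm N -> e = 1 \/ e = -1 ->
  N (e * x) (e * y) = N x y.
Proof. by move=> HN [] ->; rewrite ?mul1r// !mulN1r hexagonal_normN. Qed.

Lemma det_first_sector N m x y x' y' : hexagonal_norm N -> 0 <= y <= x ->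
  N x y <= m -> N x' y' <= m -> `|x * y' - y * x'| <= 2 * m ^+ 2.
Proof.
move=> HN s; have [e [E]] := sector_cases x' y'.
rewrite -[N x' y'](hexagonal_norm_sign _ _ HN E).
have -> : `|x * y' - y * x'| = `|x * (e * y') - y * (e * x')|.
  by case: E => ->; rewrite ?mul1r// -normrN; congr (`| _ |); ring.
move: (e * x') (e * y') => {E}x' {}y' [] s' h h'.
- exact: det_same_sector HN s s' h h'.
- exact: det_adjacent_sectors HN s s' h h'.
(* The third sector is adjacent to the negative of the first; in the coordinates of the double
   rotation these become the first and second sectors. *)
have HR := hexagonal_norm_rotation (hexagonal_norm_rotation HN).
have -> : `|x * y' - y * x'| = `|(y' - x') * x - (- x') * (x - y)|.
  by congr (`| _ |); ring.
apply: det_adjacent_sectors HR _ _ _ _; rewrite /hexagon_rotation; [lra|lra| |].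
  have -> : y' - x' - - x' = y' by ring.
  by have -> : y' - (y' - x') = x' by ring.
have -> : x - y - x = - y by ring.
have -> : - y - (x - y) = - x by ring.
by rewrite hexagonal_normN.
Qed.

(* The rotation permutes the three sectors (up to sign) cyclically and preserves
   determinants, so the first point can be moved into the first sector. *)
Lemma det_hexagonal_norm N m x y x' y' : hexagonal_norm N ->
  N x y <= m -> N x' y' <= m -> `|x * y' - y * x'| <= 2 * m ^+ 2.
Proof.
move=> HN; have [e [E]] := sector_cases x y.
rewrite (det_sign _ _ _ _ E) -[N x y](hexagonal_norm_sign _ _ HN E).
have HR := hexagonal_norm_rotation HN; have HRR := hexagonal_norm_rotation HR.
move: (e * x) (e * y) => {E}x {}y [] s.
- exact: det_first_sector HN s.
- rewrite !(hexagon_rotationE N) => h h'.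
  have -> : x * y' - y * x' = y * (y' - x') - (y - x) * y' by ring.
  by apply: det_first_sector HR _ h h'; lra.
- rewrite !(hexagon_rotationE N) !(hexagon_rotationE (hexagon_rotation N)) => h h'.
  have -> : x * y' - y * x' =
    (y - x) * (y' - x' - y') - (y - x - y) * (y' - x') by ring.
  by apply: det_first_sector HRR _ h h'; lra.
Qed.

End HexagonalNorm.

(** * Areas of parallelograms and the minimum [Delta] *)

Section Approximation.
Set Implicit Arguments.
Unset Strict Implicit.
Local Open Scope classical_set_scope.
Context {R : realType}.
Implicit Types (F : R * R -> R) (P Q U V : R * R) (alpha c s t : R) (p q : int).

Local Notation det U V := (U.1 * V.2 - U.2 * V.1).

(** A relation [a *: Q = b *: P] forces |a| = |b| = |a + b|, hence a = 0. If the determinant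
    vanished, both coordinates of [P] could serve as [a], so [P] would be 0. *)
Lemma unit_parallelogram_det_neq0 F P Q : is_norm F ->
  F P = 1 -> F Q = 1 -> F (P + Q) = 1 -> det P Q != 0.
Proof.
move=> [_ _ FZ _] FP FQ FPQ; apply/eqP; case: P FP FPQ => p1 p2.
case: Q FQ => q1 q2 /= FQ FP FPQ d0.
have dep a b : a *: (q1, q2) = b *: (p1, p2) :> R * R -> a = 0.
  move=> ab.
  have e1 : `|a| = `|b| by rewrite -[LHS]mulr1 -FQ -FZ ab FZ FP mulr1.
  have e2 : `|a| = `|a + b|.
    rewrite -[LHS]mulr1 -FPQ -FZ -[RHS]mulr1 -FP -FZ.
    by congr F; rewrite scalerDr ab scalerDl.
  have sq (x : R) : `|x| ^+ 2 = x ^+ 2 by rewrite real_normK// num_real.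
  have e1' : a ^+ 2 = b ^+ 2 by rewrite -sq e1 sq.
  have e2' : a ^+ 2 = (a + b) ^+ 2 by rewrite -sq e2 sq.
  have /eqP : a * (a + 2 * b) = 0 by nra.
  rewrite mulf_eq0 => /orP[/eqP//|/eqP h].
  have -> : a = - 2 * b by lra.
  have /eqP : b ^+ 2 = 0 by nra.
  by rewrite sqrf_eq0 => /eqP ->; rewrite mulr0.
have z1 : p1 = 0.
  by apply: (@dep p1 q1); congr pair; rewrite /GRing.scale /=; lra.
have z2 : p2 = 0.
  by apply: (@dep p2 q2); congr pair; rewrite /GRing.scale /=; lra.
have := FZ 0 (p1, p2); rewrite normr0 mul0r z1 z2 scaler0.
by move: FP; rewrite z1 z2 => -> /eqP; rewrite oner_eq0.
Qed.

Lemma det_le_Delta F (m : R) U V : is_norm F -> strongly_symmetric F ->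
  F U <= m -> F V <= m -> `|det U V| <= 2 * Delta F * m ^+ 2.
Proof.
move=> Fn Fs FU FV; have [+ _] := Delta_min Fn Fs.
rewrite {1}/parallelogram_areas boundary_unit_ball// => -[P [Q [/= FP FQ FPQ ->]]].
have D0 := unit_parallelogram_det_neq0 Fn FP FQ FPQ.
have [_ _ FZ FD] := Fn.
pose N x y := F (x *: P + y *: Q).
have HN : hexagonal_norm N.
  rewrite /N; split => [a x y|x y x' y'|||].
  - by rewrite -!scalerA -scalerDr FZ.
  - by rewrite !scalerDl addrACA.
  - by rewrite scale1r scale0r addr0.
  - by rewrite scale1r scale0r add0r.
  - by rewrite !scale1r.
(* Cramer's rule. The change of basis multiplies determinants by [det P Q], whose absolute value is
   [Delta F]. *)
have coord W : F W = N (det W Q / det P Q) (det P W / det P Q).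
  rewrite /N; congr F; case: W => w1 w2; congr pair; rewrite /= /GRing.scale /=;
  by field.
have h := det_hexagonal_norm HN (eq_ind _ (fun z => z <= m) FU _ (coord U))
   (eq_ind _ (fun z => z <= m) FV _ (coord V)).
rewrite (_ : det U V = (det U Q / det P Q * (det P V / det P Q) -
   det P U / det P Q * (det V Q / det P Q)) * det P Q); last by field.
by rewrite normrM [leRHS]mulrAC ler_wpM2r.
Qed.

Lemma Delta_gt0 F : is_norm F -> strongly_symmetric F -> 0 < Delta F.
Proof.
move=> Fn Fs; have [_ F01 _ F10 _] := Fs.
have := @det_le_Delta F 1 (1, 0) (0, 1) Fn Fs.
rewrite F01 F10 /= => /(_ (lexx _) (lexx _)).
by rewrite mulr1 mul0r subr0 normr1 expr1n; lra.
Qed.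

(** * Dirichlet's theorem and finiteness of the threshold *)

Lemma dirichlet alpha (n : nat) : exists p q, [/\ 0 < q, q%:~R <= n.+1%:R :> R &
  `|p%:~R - alpha * q%:~R| * n.+1%:R < 1].
Proof.
pose fr (k : nat) : R := k%:R * alpha - (Num.floor (k%:R * alpha))%:~R.
have fr0 k : 0 <= fr k by rewrite subr_ge0; case/andP: (floor_itv (k%:R * alpha)).
have fr1 k : fr k < 1.
  by rewrite ltrBlDl; have/andP[_] := floor_itv (k%:R * alpha); rewrite intrD.
have nfr0 k : 0 <= fr k * n.+1%:R by rewrite mulr_ge0.
(* Pigeonhole: the fractional parts for [k] from 0 to n + 1 fall into n + 1 boxes of width 1/(n +
   1). *)
pose box (k : nat) := Num.truncn (fr k * n.+1%:R).
have boxn k : (box k < n.+1)%N.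
  rewrite -(ltr_nat R).
  have/andP[h _] := truncn_itv (nfr0 k); apply: le_lt_trans h _.
  by rewrite gtr_pMl.
pose f (k : 'I_n.+2) : 'I_n.+1 := Ordinal (boxn k).
have /injectivePn[i [j ij fij]] : ~~ injectiveb f.
  by apply/negP => /injectiveP/leq_card; rewrite !card_ord ltnn.
wlog lt_ij : i j ij fij / (i < j)%N.
  move=> H; have := ij; rewrite -val_eqE neq_ltn => /orP[|] h.
    exact: H h.
  by apply: (H j i) => //; rewrite eq_sym.
have bij : box i = box j by have := congr1 val fij.
exists (Num.floor (j%:R * alpha) - Num.floor (i%:R * alpha)), (j%:Z - i%:Z).
have qE : (j%:Z - i%:Z)%:~R = j%:R - i%:R :> R by rewrite intrB.
split.
- by rewrite subr_gt0 ltz_nat.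
- rewrite qE -natrB ?(ltnW lt_ij)// ler_nat.
  by rewrite (leq_trans (leq_subr _ _))// -ltnS.
- rewrite qE intrB -[n.+1%:R](@ger0_norm R)// -normrM.
  rewrite [X in `|X|](_ : _ = fr i * n.+1%:R - fr j * n.+1%:R); last by rewrite /fr; ring.
  have := truncn_itv (nfr0 i); have := truncn_itv (nfr0 j).
  rewrite -/(box i) -/(box j) bij -natr1 => /andP[? ?] /andP[? ?].
  by rewrite ltr_norml; apply/andP; split; lra.
Qed.

Lemma has_approx_bounded F alpha t : is_norm F -> strongly_symmetric F ->
  1 <= t -> has_approx F alpha (9 * Delta F + 1) t.
Proof.
move=> Fn Fs t1; have D0 := Delta_gt0 Fn Fs.
have t0 : 0 < t by lra.
have /andP[nt tn] := truncn_itv (ltW t0).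
have n0 : (0 < Num.truncn t)%N by rewrite truncn_gt0.
move: (Num.truncn t) n0 nt tn => [//|n] _ nt tn.
have [p [q [q0 qn pqn]]] := dirichlet alpha n.
exists p, q; split=> //.
set x := q%:~R; set y := p%:~R - alpha * q%:~R.
have x0 : 0 <= x by rewrite ler0z ltW.
(* Here n + 1 is the integer part of [t], so [x] is at most [t], and [t] is less than 2(n + 1),
   which bounds [t * |y|] by 2. The square of 3 gives the constant 9. *)
have : scaled_norm F t (x, y) <= 3.
  apply: le_trans (norm_le_sum _ Fn Fs) _ => /=.
  rewrite !normrM gtr0_norm ?invr_gt0// (gtr0_norm t0) (ger0_norm x0).
  have : t^-1 * x <= 1 by rewrite ler_pdivrMl// mulr1 (le_trans qn).
  have : t * `|y| <= 2.
    have := normr_ge0 y; move: pqn; rewrite -/y.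
    have : 1 <= n.+1%:R :> R by rewrite ler1n.
    by move: tn; rewrite -natr1; nra.
  by lra.
have : 0 <= scaled_norm F t (x, y) by case: Fn => + _ _ _; apply.
move: (scaled_norm _ _ _) => z z0 z3.
have z9 : z ^+ 2 <= 9 by nra.
have := ler_wpM2l (ltW D0) z9; lra.
Qed.

(** * Approximations with constant below one half *)

Lemma near_approx F alpha c s p q : is_norm F -> strongly_symmetric F ->
  0 < s ->
  Delta F * scaled_norm F s (q%:~R, p%:~R - alpha * q%:~R) ^+ 2 < c ->
  \forall t \near s,
    Delta F * scaled_norm F t (q%:~R, p%:~R - alpha * q%:~R) ^+ 2 < c.
Proof.
move=> Fn Fs s0; set X := (_, _).
suff cvgX : Delta F * scaled_norm F t X ^+ 2 @[t --> s] -->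
    Delta F * scaled_norm F s X ^+ 2 by move=> Xc; exact: cvgr_lt cvgX _ Xc.
apply: cvgMl_tmp.
apply: (@cvg_comp _ _ _ (fun t => scaled_norm F t X) (fun x => x ^+ 2) _
   (nbhs (scaled_norm F s X))); last exact: exprn_continuous.
apply: (@cvg_comp R (R * R)%type R (fun t : R => (t^-1 * X.1, t * X.2)) F _
    (@nbhs (R * R)%type (R * R)%type (s^-1 * X.1, s * X.2))).
  apply: (@cvg_pair R R R (nbhs s) (nbhs (s^-1 * X.1)) (nbhs (s * X.2)) _ _ _
    (fun t => t^-1 * X.1) (fun t => t * X.2)).
    by apply: cvgMr_tmp; apply: cvgV; [rewrite gt_eqF|exact: cvg_id].
  by apply: cvgMr_tmp; exact: cvg_id.
exact: (Defs.norm_continuous Fn Fs).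
Qed.

Lemma irrational_sub_neq0 alpha p q : irrational alpha -> 0 < q ->
  p%:~R - alpha * q%:~R != 0 :> R.
Proof.
move=> irr q0; apply/negP; rewrite subr_eq0 => /eqP h; apply: irr.
exists (p%:Q / q%:Q) => //.
have q0' : q%:~R != 0 :> R by rewrite intr_eq0 gt_eqF.
by rewrite fmorph_div /= !ratr_int h mulfK.
Qed.

(* The area of the lattice parallelogram is a positive integer unless it
   degenerates. *)
Lemma approx_collinear F alpha c t p q p' q' :
  is_norm F -> strongly_symmetric F -> 0 < t -> c < 1 / 2 ->
  Delta F * scaled_norm F t (q%:~R, p%:~R - alpha * q%:~R) ^+ 2 < c ->
  Delta F * scaled_norm F t (q'%:~R, p'%:~R - alpha * q'%:~R) ^+ 2 < c ->
  p * q' = p' * q.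
Proof.
move=> Fn Fs t0 c2; rewrite /scaled_norm /=.
set U := (_, _); set V := (_, _) => FU FV.
have DUV : det U V = (q * p' - q' * p)%:~R.
  by rewrite /U /V /= intrB !intrM; field; rewrite gt_eqF.
pose m := Num.max (F U) (F V).
have := @det_le_Delta F m U V Fn Fs.
rewrite /m !le_max !lexx orbT /= => /(_ isT isT).
have : Delta F * (Num.max (F U) (F V)) ^+ 2 < c.
  by have [_|_] := leP (F U) (F V).
rewrite DUV -intr_norm => h1 h2.
(* The area is at most 2 [Delta F] m^2 < 2c < 1; this is where 1/2 enters. *)
have : `|q * p' - q' * p| < 1.
  by rewrite -(ltr_int R); move: h1 h2; move: (`|_|%:~R) => z; lra.
rewrite -lez1D => h; have : `|q * p' - q' * p| = 0.
  by apply/le_anti; rewrite normr_ge0 andbT; lra.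
by move/normr0_eq0; lra.
Qed.

(* The parameters at which a point on a fixed rational line approximates well
   form a bounded set; beyond its supremum another line must take over, and at
   the switch two independent points approximate well simultaneously. *)
Lemma not_eventually_approx F alpha c (T : R) :
  is_norm F -> strongly_symmetric F -> irrational alpha -> c < 1 / 2 ->
  exists2 t, T < t & ~ has_approx F alpha c t.
Proof.
move=> Fn Fs irr c2; apply: contrapT => noT.
have ap t : T < t -> has_approx F alpha c t.
  by move=> Tt; apply: contrapT => nt; apply: noT; exists t.
have D0 := Delta_gt0 Fn Fs.
pose good t p q :=
  Delta F * scaled_norm F t (q%:~R, p%:~R - alpha * q%:~R) ^+ 2 < c.
pose t0 := Num.max T 0 + 1.
have t0T : T < t0.
  by rewrite ltr_pwDr// le_max lexx.
have t0p : 0 < t0 by rewrite ltr_pwDr// le_max lexx orbT.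
have [p0 [q0 [q0p g0]]] := ap _ t0T.
pose S := [set t | t0 <= t /\ exists p q, [/\ 0 < q, p * q0 = p0 * q & good t p q]].
have S0 : S t0 by split=> //; exists p0, q0.
pose th := `|p0%:~R - alpha * q0%:~R|.
have th0 : 0 < th by rewrite normr_gt0 irrational_sub_neq0.
(* On the fixed line, |y| = th q / q0 is at least th / q0, while t|y| is at most the norm z with z^2
   < c / [Delta F]. The estimate z <= z^2 + 1 avoids a square root. *)
have ubS : ubound S ((c / Delta F + 1) * q0%:~R / th).
  move=> t [t0t [p [q [qp pq g]]]].
  have tp : 0 < t by lra.
  have q1 : 1 <= q%:~R :> R by rewrite ler1z -gtz0_ge1.
  have q01 : 1 <= q0%:~R :> R by rewrite ler1z -gtz0_ge1.
  set y := p%:~R - alpha * q%:~R.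
  have yE : `|y| * q0%:~R = th * q%:~R.
    rewrite /th -[q0%:~R in LHS](@ger0_norm R) 1?[q%:~R in RHS](_ : _ = `|q%:~R|).
    - rewrite -!normrM; congr (`|_|); rewrite /y.
      rewrite !mulrBl -!intrM pq; ring.
    - by rewrite ger0_norm//; lra.
    - by lra.
  have [_ h] := norm_ge_coord (t^-1 * q%:~R) (t * y) Fn Fs.
  move: g; rewrite /good /scaled_norm /= -/y.
  move: (F _) h => z; rewrite normrM (gtr0_norm tp) => h.
  rewrite mulrC -ltr_pdivlMr// => zc.
  rewrite ler_pdivlMr//.
  apply: (@le_trans _ _ (t * `|y| * q0%:~R)).
    by rewrite -mulrA yE ler_pM2l// ler_peMr// ltW.
  by rewrite ler_wpM2r; [|lra|apply: le_trans h _; nra].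
have hS : has_sup S by split; [exists t0|exists ((c / Delta F + 1) * q0%:~R / th)].
pose s := sup S.
have t0s : t0 <= s by apply: ub_le_sup => //; case: hS.
have sp : 0 < s by lra.
(* A point good at [s] is also good on both sides of [s]. Just below, it shares a parameter [s']
   with a point of the original line, hence lies on that line; just above, it contradicts the choice
   of [s]. *)
have [p [q [qp g]]] := ap s (lt_le_trans t0T t0s).
have /nbhs_ballP[e /= e0 eP] := near_approx Fn Fs sp g.
have [s' Ss' es'] := sup_adherent e0 hS.
have s's : s' <= s by apply: ub_le_sup => //; case: hS.
have [t0s' [p' [q' [q'p pq' g']]]] := Ss'.
have gs' : good s' p q.
  apply: eP; rewrite /ball /= ger0_norm; move: es'; rewrite -/s; lra.
have pq : p * q' = p' * q.
  by apply: approx_collinear c2 gs' g' => //; lra.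
have pq0 : p * q0 = p0 * q.
  apply: (@mulIf _ q'); first by rewrite gt_eqF.
  by rewrite mulrAC pq mulrAC pq' mulrAC.
have Se : S (s + e / 2).
  split; first by lra.
  exists p, q; split=> //; apply: eP.
  by rewrite /ball /= opprD addrA subrr sub0r normrN gtr0_norm; lra.
have : s + e / 2 <= s by apply: ub_le_sup => //; case: hS.
by lra.
Qed.

End Approximation.

Theorem theorem2 (R : realType) (F : R * R -> R) (alpha : R)
  (F_norm : is_norm F) (F_sym : strongly_symmetric F)
  (alpha_irr : irrational alpha) :
  1 / 2 <= delta F alpha.
Proof.
(* The threshold is [inf E]: [E] is upward closed, nonempty by Dirichlet's theorem and bounded below
   by 1/2. Its existence matters, since otherwise [delta] would be the supremum of the empty set. *)
pose E : set R := [set c | \forall t \near +oo, has_approx F alpha c t]%classic.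
have E0 : E (9 * Delta F + 1).
  by exists 1; split; [exact: num_real|move=> t /ltW; exact: has_approx_bounded].
have lbE : lbound E (1 / 2).
  move=> c [T [_ TP]]; rewrite leNgt; apply/negP => c2.
  have [t Tt] := not_eventually_approx T F_norm F_sym alpha_irr c2.
  by apply; exact: TP.
suff tE : threshold F alpha (inf E).
  by rewrite (delta_threshold tE); apply: lb_le_inf => //; exists (9 * Delta F + 1).
split=> c.
  have nE : (E !=set0)%classic by exists (9 * Delta F + 1).
  move=> /(inf_lt nE)[c' Ec' c'c].
  apply: filterS Ec' => t [p [q [q0 h]]]; exists p, q; split=> //.
  exact: lt_trans h c'c.
move=> cE T; apply: contrapT => noT.
have : inf E <= c.
  apply: ge_inf; first by exists (1 / 2).
  exists T; split; first exact: num_real.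
  by move=> t Tt; apply: contrapT => nt; apply: noT; exists t.
by rewrite leNgt cE.
Qed.
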